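(* Let $\Sigma$ be an order-sorted signature and let $A$ and $B$ be finite sets (read as conjunctions) of $\Sigma$-clauses such that $B$ is not $\Sigma$-unsatisfiable. If $A\,\&\,B$ is $\Sigma$-unsatisfiable, then there is a finite set $I$ of $\Sigma$-clauses such that (a) $A\vdash_{\Sigma\text{-}res} I$, (b) $I\,\&\,B$ is $\Sigma$-unsatisfiable, and (c) every predicate symbol occurring in $I$ occurs in both $A$ and $B$.
   Context: Order-sorted signature $\Sigma=(S,P,F)$: a finite poset of sorts $(S,\preceq)$ with greatest element $\top$ and least element $\bot$; predicate symbol sets $P_w$ ($w\in S^*$); function symbol sets $F_{w,s}$. Each $s\in S\setminus\{\top,\bot\}$ has a unary sort predicate $s(\cdot)$ with argument sort $\top$. Every sort except $\bot$ has a ground term. Variables are sorted ($x{:}s$); in well-sorted terms/atoms an argument of declared sort $s_i$ has sort $\preceq s_i$. A $\Sigma$-clause is a finite set of well-sorted literals, read as the universal closure of their disjunction. A $\Sigma$-structure interprets sort $s$ as a set $A_s$ ($A_\top\neq\emptyset$, $A_\bot=\emptyset$, $s_1\preceq s_2\Rightarrow A_{s_1}\subseteq A_{s_2}$), predicates of $P_{s_1\cdots s_n}$ as subsets of $A_{s_1}\times\cdots\times A_{s_n}$, functions of $F_{s_1\cdots s_n,s}$ as maps into $A_s$, and sort predicate $s$ as $A_s$; variables of sort $s$ range over $A_s$. A set of $\Sigma$-clauses is $\Sigma$-unsatisfiable if it has no such model. $\Sigma$-resolution: a $\Sigma$-substitution maps each variable $x$ to a well-sorted term $t$ with sort of $t$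 $\preceq$ sort of $x$; a $\Sigma$-unifier of a set of formulae is a $\Sigma$-substitution unifying them; it is assumed that every set of sorts has a greatest lower bound in $(S,\preceq)$, so that $\Sigma$-unifiable sets have a unique most general $\Sigma$-unifier ($\Sigma$-mgu). For $\Sigma$-clauses $C_1,C_2$ with variables standardized apart, $m\subseteq C_1$, $n\subseteq C_2$, if $m\cup\neg n$ is $\Sigma$-unifiable with $\Sigma$-mgu $\sigma$, then $(C_1-m)\sigma\cup(C_2-n)\sigma$ is a $\Sigma$-resolvent. If $C=\{L_1,L_2\}\cup D$ with $L_1,L_2$ $\Sigma$-unifiable by $\Sigma$-mgu $\sigma$, then $(\{L_1\}\cup D)\sigma$ is a factor of $C$. $\Gamma\vdash_{\Sigma\text{-}res}C$ means there is a sequence of $\Sigma$-clauses ending in $C$, each a member of $\Gamma$, a $\Sigma$-resolvent of earlier ones, or a factor of an earlier one; $\Gamma\vdash_{\Sigma\text{-}res}I$ means every clause of $I$ is so derivable. Standing assumption: the sort hierarchy is given by a sort module expressed as a first-order definite program (set of definite clauses), used for checking sort relations in $\Sigma$-substitutions.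
   Formalization: The clauses of A and B are assumed to contain no sort predicates s(·); otherwise the claim fails, e.g. A = {¬s(c)} with c of sort s and B empty: A is Σ-unsatisfiable but Σ-resolution derives no empty clause. *)

(* Defs.v *)
From HB Require Import structures.
From mathcomp Require Import all_boot all_order finmap.
From Stdlib Require List.

Set Implicit Arguments.
Unset Strict Implicit.
Unset Printing Implicit Defensive.

Local Open Scope fset_scope.

(* P_w is the set of p with [pargs p = w]; F_{w,s} is the set of f with
   [fargs f = w] and [fres f = s].  [psymb] holds the predicate symbols other
   than the sort predicates, which are added in [predsym]. *)
Record signature := Signature {
  sort_disp : Order.disp_t;
  sorts : finTBPOrderType sort_disp;
  psymb : choiceType;
  fsymb : choiceType;
  pargs : psymb -> seq sorts;
  fargs : fsymb -> seq sorts;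
  fres : fsymb -> sorts }.

Section Syntax.
Variable Sg : signature.
Local Notation S := (sorts Sg).

Definition predsym : Type :=
  ({s : S | (s != \top)%O && (s != \bot)%O} + psymb Sg)%type.

Definition predsym_args (p : predsym) : seq S :=
  match p with inl _ => [:: \top%O] | inr q => pargs q end.

(* No variable has sort \bot: such a variable would range over the empty set. *)
Definition var : Type := (nat * {s : S | (s != \bot)%O})%type.

Definition vsort (x : var) : S := val x.2.

Inductive term : Type :=
  | Var of var
  | App of fsymb Sg & seq term.

Fixpoint term_encode (t : term) : GenTree.tree (var + fsymb Sg) :=
  match t with
  | Var x => GenTree.Leaf (inl x)
  | App f ts => GenTree.Node 0 (GenTree.Leaf (inr f) :: map term_encode ts)
  end.

Fixpoint term_decode (u : GenTree.tree (var + fsymb Sg)) : option term :=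
  match u with
  | GenTree.Leaf (inl x) => Some (Var x)
  | GenTree.Node 0 (GenTree.Leaf (inr f) :: us) =>
      Some (App f (pmap term_decode us))
  | _ => None
  end.

Lemma term_encodeK : pcancel term_encode term_decode.
Proof.
rewrite /pcancel; fix IH 1 => -[x|f ts] //=; congr (Some (App f _)).
by elim: ts => //= t ts ->; rewrite IH.
Qed.

HB.instance Definition _ := Choice.copy term (pcan_type term_encodeK).

Definition sort_of (t : term) : S :=
  match t with Var x => vsort x | App f _ => fres f end.

Fixpoint well_sorted (t : term) : bool :=
  match t with
  | Var _ => true
  | App f ts =>
      all2 (fun u s => well_sorted u && (sort_of u <= s)%O) ts (fargs f)
  end.

Fixpoint occurs (x : var) (t : term) : bool :=
  match t with
  | Var y => x == y
  | App _ ts => has (occurs x) ts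
  end.

Definition atom : Type := (predsym * seq term)%type.

(* [(true, a)] is the literal a and [(false, a)] the literal not-a. *)
Definition literal : Type := (bool * atom)%type.

Definition literal_pred (L : literal) : predsym := L.2.1.
Definition literal_args (L : literal) : seq term := L.2.2.
Definition neg (L : literal) : literal := (~~ L.1, L.2).

Definition well_sorted_literal (L : literal) : bool :=
  all2 (fun u s => well_sorted u && (sort_of u <= s)%O)
       (literal_args L) (predsym_args (literal_pred L)).

Definition clause : Type := {fset literal}.

Definition sigma_clause (C : clause) : Prop :=
  forall L, L \in C -> well_sorted_literal L.

Definition sigma_clauses (G : {fset clause}) : Prop :=
  forall C, C \in G -> sigma_clause C.

Definition occurs_clause (x : var) (C : clause) : Prop :=
  exists2 L, L \in C & has (occurs x) (literal_args L).

Definition pred_occurs (p : predsym) (G : {fset clause}) : Prop :=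
  exists C L, [/\ C \in G, L \in C & literal_pred L = p].

(* Sort facts belong to the sort module (the definite program read off from the
   order of the sorts and the declarations of the symbols), which is consulted
   through [sort_of] and <= in substitutions; resolution cannot refute a sort
   literal such as not-s(c) with c of sort s, although it is false in every
   structure. *)
Definition sort_predicate_free (G : {fset clause}) : Prop :=
  forall s, ~ pred_occurs (inl s) G.

Definition has_glbs : Prop :=
  forall X : {set S}, exists g : S,
    forall s : S, (s <= g)%O <-> (forall t, t \in X -> (s <= t)%O).

Definition sorts_inhabited : Prop :=
  forall s : S, s <> \bot%O ->
    exists t, [/\ well_sorted t, forall x, ~~ occurs x t & (sort_of t <= s)%O].

Fixpoint subst_term (sigma : var -> term) (t : term) : term :=
  match t with
  | Var x => sigma x
  | App f ts => App f (map (subst_term sigma) ts)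
  end.

Definition subst_literal (sigma : var -> term) (L : literal) : literal :=
  (L.1, (literal_pred L, map (subst_term sigma) (literal_args L))).

Definition subst_clause (sigma : var -> term) (C : clause) : clause :=
  [fset subst_literal sigma L | L in C].

Definition sigma_subst (sigma : var -> term) : Prop :=
  forall x, well_sorted (sigma x) /\ (sort_of (sigma x) <= vsort x)%O.

Definition sigma_unifier (sigma : var -> term) (E : {fset literal}) : Prop :=
  sigma_subst sigma /\
  forall L1 L2, L1 \in E -> L2 \in E ->
    subst_literal sigma L1 = subst_literal sigma L2.

(* The factorisation through sigma holds at all variables, not only at those of
   E, so that applying sigma to the rest of a clause loses no generality. *)
Definition sigma_mgu (sigma : var -> term) (E : {fset literal}) : Prop :=
  sigma_unifier sigma E /\
  forall tau, sigma_unifier tau E ->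
    exists2 rho, sigma_subst rho
               & forall x, tau x = subst_term rho (sigma x).

Definition renaming (r : var -> var) : Prop :=
  injective r /\ forall x, vsort (r x) = vsort x.

Definition variant (C D : clause) : Prop :=
  exists2 r, renaming r & D = subst_clause (fun x => Var (r x)) C.

(* D1 and D2 are C1 and C2 standardized apart. *)
Definition resolvent (C1 C2 C : clause) : Prop :=
  exists (D1 D2 : clause) (m n : {fset literal}) (sigma : var -> term),
    [/\ variant C1 D1, variant C2 D2
      & forall x, ~ (occurs_clause x D1 /\ occurs_clause x D2)] /\
    [/\ m `<=` D1, n `<=` D2, m != fset0, n != fset0
      & sigma_mgu sigma (m `|` [fset neg L | L in n])] /\
    C = subst_clause sigma (D1 `\` m) `|` subst_clause sigma (D2 `\` n).

Definition factor (C0 C : clause) : Prop :=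
  exists (L1 L2 : literal) (D : clause) (sigma : var -> term),
    [/\ C0 = [fset L1; L2] `|` D,
        sigma_mgu sigma [fset L1; L2]
      & C = subst_clause sigma ([fset L1] `|` D)].

Definition derivation (G : {fset clause}) (d : seq clause) : Prop :=
  forall i, i < size d ->
    [\/ nth fset0 d i \in G,
        exists j k, [/\ j < i, k < i
          & resolvent (nth fset0 d j) (nth fset0 d k) (nth fset0 d i)]
      | exists2 j, j < i & factor (nth fset0 d j) (nth fset0 d i)].

Definition derives (G : {fset clause}) (C : clause) : Prop :=
  exists d : seq clause, derivation G (rcons d C).

Definition derives_all (G I : {fset clause}) : Prop :=
  forall C, C \in I -> derives G C.

End Syntax.

Section Semantics.
Variable Sg : signature.

(* Symbols are interpreted on all argument lists; the values of [fun_int] on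
   lists that do not respect the declared argument sorts are irrelevant. *)
Record structure := Structure {
  dom :> Type;
  sort_int : sorts Sg -> dom -> Prop;
  fun_int : fsymb Sg -> seq dom -> dom;
  psymb_int : psymb Sg -> seq dom -> Prop;
  top_nonempty : exists a, sort_int \top%O a;
  bot_empty : forall a, ~ sort_int \bot%O a;
  sort_int_mono : forall s1 s2, (s1 <= s2)%O ->
    forall a, sort_int s1 a -> sort_int s2 a;
  fun_int_sort : forall f ds,
    List.Forall2 (fun a s => sort_int s a) ds (fargs f) ->
    sort_int (fres f) (fun_int f ds);
  psymb_int_sort : forall p ds, psymb_int p ds ->
    List.Forall2 (fun a s => sort_int s a) ds (pargs p) }.

Variable M : structure.

Definition pred_int (p : predsym Sg) (ds : seq M) : Prop :=
  match p with
  | inl s => exists2 a, ds = [:: a] & sort_int (val s) a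
  | inr q => psymb_int q ds
  end.

Fixpoint eval (v : var Sg -> M) (t : term Sg) : M :=
  match t with
  | Var x => v x
  | App f ts => fun_int f (map (eval v) ts)
  end.

Definition holds_literal (v : var Sg -> M) (L : literal Sg) : Prop :=
  let a := pred_int (literal_pred L) (map (eval v) (literal_args L)) in
  if L.1 then a else ~ a.

Definition assignment (v : var Sg -> M) : Prop :=
  forall x, sort_int (vsort x) (v x).

Definition models (G : {fset clause Sg}) : Prop :=
  forall C, C \in G -> forall v, assignment v ->
    exists2 L, L \in C & holds_literal v L.

End Semantics.

Definition sigma_unsat (Sg : signature) (G : {fset clause Sg}) : Prop :=
  forall M : structure Sg, ~ models M G.

(* Main.v *)
Require Import Defs.
From mathcomp Require Import all_boot all_order finmap.
From mathcomp Require Import boolp classical_sets filter.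

(* The structure whose elements are the well-sorted terms shows that A & B is
   unsatisfiable only if the set of its substitution instances is propositionally
   unsatisfiable, and then finitely many instances are.  From the instances of A
   among them, eliminate by propositional resolution (Davis-Putnam) each atom whose
   predicate symbol does not occur in B; the outcome is still inconsistent with
   the instances of B.  I consists of the Sigma-clauses obtained by lifting these
   propositional derivations to Sigma-resolution.

   Lifting needs most general Sigma-unifiers.  They are obtained without a
   unification algorithm, as the least general generalization of all unifiers
   taken together: anti-unify the family of their values position by position,
   and where the head symbols disagree put a variable which names the family of
   subterms and whose sort is the least upper bound of their sorts. *)

Set Implicit Arguments.
Unset Strict Implicit.
Unset Printing Implicit Defensive.

Import Order.Theory.

Local Open Scope fset_scope.

(** * Propositional compactness and Davis-Putnam elimination *)

Section Propositional.
Variable T : choiceType.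
Implicit Types (V : T -> bool) (C D : {fset (bool * T)}).
Implicit Types (G : {fset {fset (bool * T)}}).

Definition sat V C := has (fun L => V L.2 == L.1) (enum_fset C).

Lemma satP V C : reflect (exists2 L, L \in C & V L.2 = L.1) (sat V C).
Proof. by apply: (iffP hasP) => -[L LC /eqP ?]; exists L => //; apply/eqP. Qed.

(** If every finite part of [Q] had a satisfying valuation, their limit along an ultrafilter on the
    finite parts would satisfy all of [Q]: clauses are finite, so a clause false in the limit is
    false in almost all of these valuations. *)
Lemma compactness (Q : {fset (bool * T)} -> Prop) :
  (forall V, exists2 C, Q C & ~~ sat V C) ->
  exists2 G : {fset {fset (bool * T)}}, (forall C, C \in G -> Q C) &
    forall V, exists2 C, C \in G & ~~ sat V C.
Proof.
move=> unsat; apply: contrapT => fin_sat.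
have [v v_sat] : {v : {fset {fset (bool * T)}} -> T -> bool &
    forall G, (forall C, C \in G -> Q C) -> forall C, C \in G -> sat (v G) C}.
  apply: (choice (P := fun (G : {fset {fset (bool * T)}}) (w : T -> bool) =>
     (forall C, C \in G -> Q C) -> forall C, C \in G -> sat w C)) => G.
  have [GQ|nGQ] := EM (forall C, C \in G -> Q C); last by exists xpredT.
  apply: contrapT => noV; apply: fin_sat; exists G => // V.
  apply: contrapT => noC; apply: noV; exists V => _ C CG.
  by apply: contrapT => /negP nC; apply: noC; exists C.
(* [F] is generated by the cones of finite parts of [Q] that include a given one, so almost every
   [G] contains any given clause of [Q]. *)
pose F (X : {fset {fset (bool * T)}} -> Prop) :=
  exists2 G0 : {fset {fset (bool * T)}}, (forall C, C \in G0 -> Q C) &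
    forall G, (forall C, C \in G -> Q C) -> G0 `<=` G -> X G.
have Fproper : ProperFilter F.
  apply: Build_ProperFilter_ex => [X [G0 G0Q XG]|].
    by exists G0; apply: XG.
  split=> [|X Y [G1 G1Q XG] [G2 G2Q YG]|X Y XY [G0 G0Q XG]].
  - by exists fset0.
  - exists (G1 `|` G2) => [C /fsetUP[/G1Q|/G2Q]//|G GQ sub].
    by split; [apply: XG|apply: YG] => //; apply: fsubset_trans sub;
      rewrite ?fsubsetUl ?fsubsetUr.
  - by exists G0 => // G GQ sub; apply/XY/XG.
have [U [Uultra FU]] := ultraFilterLemma Fproper.
(* The limit of the valuations [v G] along [U]. *)
pose V a := `[< U (fun G => v G a) >].
have [C QC /negP] := unsat V; apply; apply: contrapT => nsat.
have UC : U (fun G => sat (v G) C).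
  apply: FU; exists [fset C] => [D|G GQ sub].
    by rewrite inE => /eqP->.
  by apply: v_sat => //; apply: (fsubsetP sub); rewrite inE.
have Unot L : L \in C -> U (fun G => v G L.2 != L.1).
  move=> LC.
  have [//|Ueq] := in_ultra_setVsetC (fun G => v G L.2 != L.1) Uultra.
  case: nsat; apply/satP; exists L => //.
  have {}Ueq : U (fun G => v G L.2 = L.1).
    by apply: filterS Ueq => G /= /negP; rewrite negbK => /eqP.
  case: L Ueq {LC} => -[] a /= Ueq; rewrite /V; first exact/asboolP.
  apply/asboolPn => Ua; apply: (@filter_not_empty _ U _).
  apply: filterS (filterI Ua Ueq) => G [] /=.
  by move=> -> .
have : U (fun G => forall L, L \in enum_fset C -> v G L.2 != L.1).
  have : forall L, L \in enum_fset C -> U (fun G => v G L.2 != L.1) by exact: Unot.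
  elim: (enum_fset C) => [|L s IH] Us.
    by apply: filterS filterT => G _ L.
  have Us' := IH (fun L' L's => Us L' (mem_behead (s := L :: s) L's)).
  apply: filterS (filterI (Us L (mem_head _ _)) Us') => G [G1 G2] L'.
  by rewrite inE => /orP[/eqP->|/G2].
move=> Uall; apply: (@filter_not_empty _ U _).
apply: filterS (filterI UC Uall) => G [/satP[L LC eL] /(_ L LC)].
by rewrite eL eqxx.
Qed.

Definition upd V a b : T -> bool := fun c => if c == a then b else V c.

(** [G'] keeps the clauses free of [a], adds all resolvents on [a], and drops the tautologies that
    contain both literals of [a]. [Q] is an invariant of resolution; it will later carry the lifting
    to clauses with variables. *)
Lemma eliminate_atom (Q : {fset (bool * T)} -> Prop) (a : T) G :
  (forall C D, Q C -> Q D -> (true, a) \in C -> (false, a) \in D ->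
     Q ((C `\ (true, a)) `|` (D `\ (false, a)))) ->
  (forall C, C \in G -> Q C) ->
  exists G' : {fset {fset (bool * T)}}, [/\ forall C, C \in G' -> Q C,
    forall C L, C \in G' -> L \in C -> L.2 != a,
    forall C L, C \in G' -> L \in C ->
      exists2 D, D \in G & L \in D &
    forall V, (forall C, C \in G' -> sat V C) ->
      exists2 V', (forall c, c != a -> V' c = V c) &
        forall C, C \in G -> sat V' C].
Proof.
move=> Qres GQ.
pose pos C := ((true, a) \in C) && ((false, a) \notin C).
pose neg C := ((true, a) \notin C) && ((false, a) \in C).
pose G0 := [fset C in G | ((true, a) \notin C) && ((false, a) \notin C)].
pose G1 := [fset (C `\ (true, a)) `|` (D `\ (false, a)) |
             C in [fset C in G | pos C], D in [fset D in G | neg D]].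
have G1P E : reflect (exists C D, [/\ C \in G, pos C, D \in G, neg D &
    E = (C `\ (true, a)) `|` (D `\ (false, a))]) (E \in G1).
  apply: (iffP idP) => [/imfset2P[C]|[C [D [CG pC DG nD ->]]]].
    rewrite !inE => /andP[CG pC] [D]; rewrite !inE => /andP[DG nD] ->.
    by exists C, D.
  by apply/imfset2P; exists C; rewrite ?inE ?CG //; exists D; rewrite ?inE ?DG.
have noa C L : L \in C -> (true, a) \notin C -> (false, a) \notin C -> L.2 != a.
  by case: L => [b c] /= LC nt nf; apply/eqP => ca; move: LC nt nf; rewrite ca;
    case: b => ->.
exists (G0 `|` G1); split.
- move=> C /fsetUP[|/G1P[D [E [DG /andP[D1 D2] EG /andP[E1 E2] ->]]]].
    by rewrite /G0 !inE => /andP[/GQ].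
  by apply: Qres => //; exact: GQ.
- move=> C L /fsetUP[CG0|/G1P[D [E [DG /andP[D1 D2] EG /andP[E1 E2] ->]]]] LC.
    by move: CG0; rewrite /G0 !inE => /andP[_ /andP[]]; exact: noa LC.
  by apply: noa LC _ _; rewrite !inE ?eqxx ?(negPf D2) ?(negPf E1) ?andbF.
- move=> C L /fsetUP[|/G1P[D [E [DG /andP[D1 D2] EG /andP[E1 E2] ->]]]].
    by rewrite /G0 !inE => /andP[CG _] LC; exists C.
  by rewrite !inE => /orP[] /andP[_ ?]; [exists D|exists E].
move=> V satV.
have upd_ne b c : c != a -> upd V a b c = V c by rewrite /upd => /negPf->.
have upd_a b : upd V a b a = b by rewrite /upd eqxx.
have sat_lit b C : (b, a) \in C -> sat (upd V a b) C.
  by move=> bC; apply/satP; exists (b, a).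
have sat_rest b C : sat V (C `\ (~~ b, a)) -> sat (upd V a b) C.
  move=> /satP[[b' c]]; rewrite !inE xpair_eqE => /andP[ne LC] /= e.
  have [ca|nca] := eqVneq c a; last by apply/satP; exists (b', c); rewrite //= upd_ne.
  apply: sat_lit; move: ne LC {e}; rewrite ca eqxx andbT.
  by case: b'; case: b.
have sat_G0 b C : C \in G0 -> sat (upd V a b) C.
  move=> CG0; have /satP[L LC e] : sat V C by apply: satV; apply/fsetUP; left.
  apply/satP; exists L => //; rewrite upd_ne //.
  by move: CG0; rewrite /G0 !inE => /andP[_ /andP[]]; exact: noa LC.
(* Set [a] to false if no clause with a positive [a] needs it. Otherwise some [C] does, and its
   resolvents force the rest of every clause with a negative [a] to hold, so [a] can be true. *)
have [allpos|] := EM (forall C, C \in G -> pos C -> sat V (C `\ (true, a))).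
  exists (upd V a false); first exact: upd_ne.
  move=> C CG; have [nC|nC] := boolP ((false, a) \in C); first exact: sat_lit.
  have [pC|pC] := boolP ((true, a) \in C).
    by apply: sat_rest; apply: allpos; rewrite /pos ?pC.
  by apply: sat_G0; rewrite /G0 !inE CG pC.
move=> /existsNP[C /not_implyP[CG /not_implyP[pC nsatC]]].
exists (upd V a true); first exact: upd_ne.
move=> D DG; have [pD|pD] := boolP ((true, a) \in D); first exact: sat_lit.
have [nD|nD] := boolP ((false, a) \in D); last first.
  by apply: sat_G0; rewrite /G0 !inE DG pD.
apply: sat_rest.
have /satP[L /fsetUP[LC|LD] e] :
    sat V ((C `\ (true, a)) `|` (D `\ (false, a))).
- by apply: satV; apply/fsetUP; right; apply/G1P; exists C, D; rewrite /neg pD nD.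
- by case: nsatC; apply/satP; exists L.
- by apply/satP; exists L.
Qed.

Lemma eliminate_atoms (Q : {fset (bool * T)} -> Prop) (P : pred T) G :
  (forall C D a, Q C -> Q D -> (true, a) \in C -> (false, a) \in D ->
     Q ((C `\ (true, a)) `|` (D `\ (false, a)))) ->
  (forall C, C \in G -> Q C) ->
  exists G' : {fset {fset (bool * T)}}, [/\ forall C, C \in G' -> Q C,
    forall C L, C \in G' -> L \in C -> ~~ P L.2 &
    forall V, (forall C, C \in G' -> sat V C) ->
      exists2 V', (forall c, ~~ P c -> V' c = V c) &
        forall C, C \in G -> sat V' C].
Proof.
move=> Qres.
(* Induction on a list of the atoms still to be eliminated; it shrinks because elimination
   introduces no new literal. *)
have [s] : exists s : seq T, forall C L, C \in G -> L \in C -> P L.2 -> L.2 \in s.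
  exists (flatten [seq [seq L.2 | L <- enum_fset C] | C <- enum_fset G]).
  move=> C L CG LC _; apply/flatten_mapP; exists C => //.
  by apply/mapP; exists L.
elim: s G => [|a s IH] G Gs GQ.
  exists G; split=> // [C L CG LC|V satV]; last by exists V.
  by apply/negP => /(Gs _ _ CG LC).
have [Pa|nPa] := boolP (P a); last first.
  apply: IH => // C L CG LC PL; move: (Gs _ _ CG LC PL); rewrite inE.
  by case: eqP => // e; rewrite -e PL in nPa.
have [G1 [G1Q G1a G1G G1sat]] := eliminate_atom (fun C D => Qres C D a) GQ.
have [|G' [G'Q G'P G'sat]] := IH G1 _ G1Q.
  move=> C L CG LC PL; have [D DG LD] := G1G _ _ CG LC.
  by move: (Gs _ _ DG LD PL); rewrite inE (negPf (G1a _ _ CG LC)).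
exists G'; split=> // V /G'sat[V1 eV1 /G1sat[V2 eV2 satV2]].
exists V2 => // c nPc; rewrite eV2 ?eV1 //.
by apply: contraNneq nPc => ->.
Qed.

End Propositional.

(** * Terms and substitutions *)

Section Terms.
Variable Sg : signature.
Implicit Types (t : term Sg) (x : var Sg) (r s : var Sg -> term Sg).

Lemma term_nested_ind (P : term Sg -> Prop) :
  (forall x, P (Var x)) ->
  (forall f ts, (forall t, t \in ts -> P t) -> P (App f ts)) ->
  forall t, P t.
Proof.
move=> PVar PApp; fix IH 1 => -[x|f ts]; first exact: PVar.
apply: PApp; elim: ts => [|t ts IHts] u.
  by clear IH; rewrite in_nil.
by rewrite inE => /orP[/eqP->|u_ts]; [exact: IH|exact: IHts].
Qed.

Lemma subst_term_comp r s t :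
  subst_term r (subst_term s t) = subst_term (fun x => subst_term r (s x)) t.
Proof.
elim/term_nested_ind: t => [x|f ts IH] //=; congr App.
by rewrite -map_comp; apply/eq_in_map => t /IH.
Qed.

Lemma sigma_subst_sorts s (sorts_ok : sigma_subst s) t w :
  well_sorted t && (sort_of t <= w)%O ->
  well_sorted (subst_term s t) && (sort_of (subst_term s t) <= w)%O.
Proof.
elim/term_nested_ind: t w => [x|f ts IH] w /=.
  by have [-> /le_trans le] := sorts_ok x => /le ->.
move=> /andP[ws ->]; rewrite andbT.
elim: ts (fargs f) IH ws => [|t ts IHts] [|w' ws] //= IH /andP[tw tsw].
rewrite IH ?mem_head //= IHts // => u u_ts.
by apply: IH; rewrite inE u_ts orbT.
Qed.

End Terms.

(** * Least general generalization of a family of substitutions *)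

Section SimultaneousGeneralization.
Variable Sg : signature.
Local Notation S := (sorts Sg).
Hypothesis glbs : has_glbs Sg.
Hypothesis no_bot : forall t : term Sg, well_sorted t -> sort_of t != \bot%O.
Variables (U : Type) (u0 : U) (sigma : U -> var Sg -> term Sg).
Hypothesis sigma_ok : forall u, sigma_subst (sigma u).
Implicit Types (t : term Sg) (T : U -> term Sg).

(** The greatest lower bound of the set of upper bounds. *)
Lemma sort_lub (P : S -> Prop) : exists g : S,
  (forall s, P s -> (s <= g)%O) /\
  (forall t : S, (forall s, P s -> (s <= t)%O) -> (g <= t)%O).
Proof.
have [g glb] :=
  glbs (finset.finset (fun t : S => `[< forall s, P s -> (s <= t)%O >])).
exists g; split=> [s Ps|t ub].
  by apply/glb => t; rewrite finset.in_set => /asboolP; apply.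
by have /glb := lexx g; apply; rewrite finset.in_set; apply/asboolP.
Qed.

(* Out of range the term itself is returned, so that every child of a
   well-sorted term is well-sorted. *)
Definition child (i : nat) t : term Sg :=
  match t with Var _ => t | App _ ts => nth t ts i end.

Lemma child_well_sorted i t : well_sorted t -> well_sorted (child i t).
Proof.
case: t => [x|f ts] // wts.
suff nth_ok (d : term Sg) us ws : well_sorted d ->
    all2 (fun u s => well_sorted u && (sort_of u <= s)%O) us ws ->
    well_sorted (nth d us i) by exact: (nth_ok (App f ts) ts (fargs f)).
move=> wd; elim: us ws i => [|u us IH] [|w ws] [|i] //= /andP[/andP[wu _] wus] //.
exact: IH wus.
Qed.

(* The type of xp is var Sg * seq nat with var Sg unfolded, so that its countType
   structure is found. *)
Definition path_family (xp : nat * {s : S | (s != \bot)%O} * seq nat) :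
    U -> term Sg :=
  fun u => foldl (fun t i => child i t) (sigma u xp.1) xp.2.

Definition reachable T := exists xp, T = path_family xp.

Lemma path_family_well_sorted xp u : well_sorted (path_family xp u).
Proof.
rewrite /path_family; have := (sigma_ok u xp.1).1.
by elim: xp.2 (sigma u _) => //= i p IH t /(child_well_sorted i)/IH.
Qed.

Lemma reachable_child i T : reachable T -> reachable (fun u => child i (T u)).
Proof.
move=> [[x p] ->]; exists (x, rcons p i).
by apply: funext => u; rewrite /path_family /= foldl_rcons.
Qed.

(* The families met while generalizing sigma are subterm families of some sigma x,
   hence indexed by the countable set of pairs (variable, path): there are enough
   variables to name them injectively. *)
Lemma exists_naming (x0 : var Sg) :
  exists (name : (U -> term Sg) -> var Sg) (back : var Sg -> U -> term Sg),
    (forall z u, well_sorted (back z u)) /\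
    forall T, reachable T -> [/\ back (name T) = T,
      forall u, (sort_of (T u) <= vsort (name T))%O &
      forall s, (forall u, sort_of (T u) <= s)%O -> (vsort (name T) <= s)%O].
Proof.
(* The index of a variable encodes a pair (variable, path). An index that encodes nothing falls back
   on the family of [x0], so that every value of [back] is well-sorted. *)
pose back (z : var Sg) :=
  if choice.unpickle z.1 is Some xp then path_family xp else path_family (x0, [::]).
have /choice[name nameP] : forall T, exists z : var Sg, reachable T ->
    [/\ back z = T, forall u, (sort_of (T u) <= vsort z)%O &
      forall s, (forall u, sort_of (T u) <= s)%O -> (vsort z <= s)%O].
  move=> T; have [[xp ->]|nT] := EM (reachable T); last by exists x0.
  have [g [ub lub]] := sort_lub (fun s => exists u, s = sort_of (path_family xp u)).
  have g_bot : (g != \bot)%O.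
    apply: contraNneq (no_bot (path_family_well_sorted xp u0)) => g0.
    by rewrite -lex0 -g0; apply: ub; exists u0.
  exists (choice.pickle xp, exist _ g g_bot) => _; split.
  - by rewrite /back /= choice.pickleK.
  - by move=> u; apply: ub; exists u.
  - by move=> s le_s; apply: lub => _ [u ->].
exists name, back; split=> // z u; rewrite /back.
by case: choice.unpickle => [xp|]; apply: path_family_well_sorted.
Qed.

Variables (name : (U -> term Sg) -> var Sg) (back : var Sg -> U -> term Sg).
Hypothesis back_ok : forall z u, well_sorted (back z u).
Hypothesis nameP : forall T, reachable T -> [/\ back (name T) = T,
  forall u, (sort_of (T u) <= vsort (name T))%O &
  forall s, (forall u, sort_of (T u) <= s)%O -> (vsort (name T) <= s)%O].

Definition term_args t : seq (term Sg) :=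
  match t with Var _ => [::] | App _ ts => ts end.

(** The default in [head] is never reached when each [Ts u] is as long as [ts], which [gen] checks
    before the call. *)
Definition gens_with (gen : term Sg -> (U -> term Sg) -> term Sg) :=
  fix gens (ts : seq (term Sg)) (Ts : U -> seq (term Sg)) : seq (term Sg) :=
    match ts with
    | [::] => [::]
    | t :: ts' => gen t (fun u => head t (Ts u)) :: gens ts' (fun u => behead (Ts u))
    end.

(** [t0] stands for the member [T u0]; it is carried along to give the recursion a structural
    argument. *)
Fixpoint gen (t0 : term Sg) (T : U -> term Sg) : term Sg :=
  match t0 with
  | Var _ => Var (name T)
  | App f ts =>
    if `[< forall u, exists2 us, T u = App f us & size us = size ts >]
    then App f (gens_with gen ts (fun u => term_args (T u)))
    else Var (name T)
  end.

Definition gen_subst (x : var Sg) : term Sg := gen (sigma u0 x) (sigma^~ x).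

(** All members of the family have the symbols of [t] down to its variables, so [gen] copies them
    and generalizes only at the variables. The result thus depends only on the family: terms that
    every [sigma u] identifies are identified by [gen_subst]. *)
Lemma gen_subst_term t :
  gen (subst_term (sigma u0) t) (fun u => subst_term (sigma u) t)
  = subst_term gen_subst t.
Proof.
elim/term_nested_ind: t => [x|f ts IH] //=.
rewrite asboolT; last first.
  by move=> u; exists (map (subst_term (sigma u)) ts); rewrite ?size_map.
congr App; elim: ts IH => [|t ts IHts] IH //=.
rewrite IH ?mem_head // IHts // => u u_ts.
by apply: IH; rewrite inE u_ts orbT.
Qed.

(** The test succeeds at the name of a reachable family; elsewhere it only ensures that a
    Sigma-substitution results. *)
Definition instantiation u (z : var Sg) : term Sg :=
  if (sort_of (back z u) <= vsort z)%O then back z u else Var z.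

Lemma instantiation_ok u : sigma_subst (instantiation u).
Proof.
by move=> z; rewrite /instantiation; case: ifP => // ->.
Qed.

(** Leastness of the sorts keeps the generalization well-sorted: all members of an argument family
    lie below the declared sort, hence so does the sort of their generalization. *)
Lemma genP t0 T : T u0 = t0 -> reachable T ->
  [/\ well_sorted (gen t0 T),
      forall s, (forall u, sort_of (T u) <= s)%O -> (sort_of (gen t0 T) <= s)%O &
      forall u, subst_term (instantiation u) (gen t0 T) = T u].
Proof.
elim/term_nested_ind: t0 T => [x|f ts IH] T Tu0 reachT.
  have [backT leT lubT] := nameP reachT.
  by split=> //= u; rewrite /instantiation backT leT.
rewrite /=; case: asboolP => [same|_]; last first.
  have [backT leT lubT] := nameP reachT.
  by split=> //= u; rewrite /instantiation backT leT.
have wsT u : well_sorted (T u).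
  by have [xp ->] := reachT; apply: path_family_well_sorted.
have Tapp u : T u = App f (term_args (T u)) by have [us ->] := same u.
pose Ts u := term_args (T u).
suff [ws inst] :
    all2 (fun u s => well_sorted u && (sort_of u <= s)%O)
      (gens_with gen ts Ts) (fargs f) /\
    forall u, map (subst_term (instantiation u))
      (gens_with gen ts Ts) = Ts u.
  split=> // [s le_s|u]; first by have := le_s u0; rewrite Tu0.
  by rewrite /= inst /Ts -Tapp.
have : Ts u0 = ts by rewrite /Ts Tu0.
have : forall u, size (Ts u) = size ts.
  by move=> u; rewrite /Ts; have [us ->] := same u.
have : forall u, all2 (fun u s => well_sorted u && (sort_of u <= s)%O)
    (Ts u) (fargs f).
  by move=> u; have := wsT u; rewrite {1}Tapp.
(* Reachability of the argument families is stated through [nth], so that it passes to tails of the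
   argument lists with a shift of [i]. *)
have : forall i T', (forall u d, i < size (Ts u) ->
    T' u = nth d (Ts u) i) -> i < size ts -> reachable T'.
  move=> i T' T'E lt_i.
  have -> : T' = fun u => child i (T u); last exact: reachable_child.
  apply: funext => u; rewrite (T'E u (T u)) //; last first.
    by rewrite /Ts; have [us -> /= ->] := same u.
  by rewrite [in RHS]Tapp /= -Tapp.
move: (fargs f) Ts => ws Ts.
elim: ts IH ws Ts {Tu0 same} => [|t ts IHts] IH [|w ws] Ts reachTs wsTs szTs Tsu0 //=.
- by split=> // u; apply/esym/size0nil; apply: szTs.
- by have := wsTs u0; rewrite Tsu0.
- by have := wsTs u0; rewrite Tsu0.
have TsE u : Ts u = head t (Ts u) :: behead (Ts u).
  by have := szTs u; case: (Ts u).
have head_t : head t (Ts u0) = t by rewrite Tsu0.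
have head_reach : reachable (fun u => head t (Ts u)).
  by apply: (reachTs 0) => // u d; rewrite TsE.
have [T'wsorted T'sort T'inst] := IH t (mem_head _ _) _ head_t head_reach.
have [ws' inst'] :
    all2 (fun u s => well_sorted u && (sort_of u <= s)%O)
      (gens_with gen ts (fun u => behead (Ts u))) ws /\
    forall u, map (subst_term (instantiation u))
      (gens_with gen ts (fun u => behead (Ts u))) = behead (Ts u).
  apply: IHts.
  - by move=> t' t'_ts; apply: IH; rewrite inE t'_ts orbT.
  - move=> i T' T'E lt_i; apply: (reachTs i.+1) => // u d lt_i'.
    by rewrite (T'E u d) ?nth_behead // size_behead szTs.
  - by move=> u; have := wsTs u; rewrite {1}TsE /= => /andP[].
  - by move=> u; rewrite size_behead szTs.
  - by rewrite Tsu0.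
split=> [|u]; last by rewrite T'inst inst' -TsE.
rewrite T'wsorted ws' andbT /=; apply: T'sort => u.
by have := wsTs u; rewrite {1}TsE /= => /andP[/andP[]].
Qed.

End SimultaneousGeneralization.

(** * Substitution in clauses and concatenation of derivations *)

Section Clauses.
Variable Sg : signature.
Implicit Types (C D : clause Sg) (L : literal Sg) (r s : var Sg -> term Sg).

Lemma subst_clauseP s C L :
  reflect (exists2 L', L' \in C & L = subst_literal s L') (L \in subst_clause s C).
Proof. exact: imfsetP. Qed.

Lemma mem_subst_clause s C L : L \in C -> subst_literal s L \in subst_clause s C.
Proof. by move=> LC; apply/subst_clauseP; exists L. Qed.

Lemma subst_literal_comp r s L :
  subst_literal r (subst_literal s L)
  = subst_literal (fun x => subst_term r (s x)) L.
Proof.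
rewrite /subst_literal /literal_args /=; congr (_, (_, _)); rewrite -map_comp.
by apply: eq_map => t /=; rewrite subst_term_comp.
Qed.

Lemma subst_clause_comp r s C :
  subst_clause r (subst_clause s C)
  = subst_clause (fun x => subst_term r (s x)) C.
Proof.
apply/fsetP => L; apply/subst_clauseP/subst_clauseP => -[L'].
  by move=> /subst_clauseP[K KC ->] ->; exists K; rewrite ?subst_literal_comp.
move=> LC ->; exists (subst_literal s L'); first exact: mem_subst_clause.
by rewrite subst_literal_comp.
Qed.

Lemma subst_clauseU s C D :
  subst_clause s (C `|` D) = subst_clause s C `|` subst_clause s D.
Proof.
apply/fsetP => L; apply/subst_clauseP/fsetUP.
  by move=> [K /fsetUP[KC|KD] ->]; [left|right]; apply: mem_subst_clause.
by case=> /subst_clauseP[K KC ->]; exists K => //; apply/fsetUP; [left|right].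
Qed.

(** Removing one literal from an instance corresponds to removing all its preimages from the
    clause. *)
Lemma subst_clause_remove s C L :
  subst_clause s (C `\` [fset K in C | subst_literal s K == L])
  = subst_clause s C `\ L.
Proof.
apply/fsetP => K; rewrite !inE; apply/subst_clauseP/andP.
  move=> [K']; rewrite !inE => /andP[/nandP[/negP//|KL] KC] ->.
  by rewrite KL mem_subst_clause.
move=> [KL /subst_clauseP[K' KC KE]]; exists K' => //.
by rewrite !inE KC /= -KE KL.
Qed.

Lemma sigma_subst_clause s C :
  sigma_subst s -> sigma_clause C -> sigma_clause (subst_clause s C).
Proof.
move=> s_ok C_ok _ /subst_clauseP[L /C_ok wL ->].
move: wL; rewrite /well_sorted_literal /literal_pred /literal_args /=.
rewrite /literal_args; elim: L.2.2 (predsym_args _) => [|t ts IH] [|w ws] //=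
  /andP[tw tsw].
by rewrite (sigma_subst_sorts s_ok tw) IH.
Qed.

Lemma derives_member (G : {fset clause Sg}) C : C \in G -> derives G C.
Proof. by move=> CG; exists [::] => -[|i] //= _; constructor 1. Qed.

Lemma derivation_cat (G : {fset clause Sg}) d1 d2 :
  derivation G d1 -> derivation G d2 -> derivation G (d1 ++ d2).
Proof.
move=> H1 H2 i; rewrite size_cat nth_cat; have [lt_i _|ge_i lt_i] := ltnP i (size d1).
  case: (H1 i lt_i) => [|[j [k [ji ki res]]]|[j ji fac]]; first by constructor 1.
    constructor 2; exists j, k; split=> //.
    by rewrite !nth_cat (ltn_trans ji lt_i) (ltn_trans ki lt_i).
  by constructor 3; exists j; rewrite // nth_cat (ltn_trans ji lt_i).
have lt_i2 : i - size d1 < size d2 by rewrite ltn_subLR.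
have nthE j : nth fset0 (d1 ++ d2) (size d1 + j) = nth fset0 d2 j.
  by rewrite nth_cat ltnNge leq_addr addKn.
case: (H2 _ lt_i2) => [|[j [k [ji ki res]]]|[j ji fac]]; first by constructor 1.
  constructor 2; exists (size d1 + j)%N, (size d1 + k)%N.
  by rewrite !nthE -!ltn_subRL.
by constructor 3; exists (size d1 + j)%N; rewrite ?nthE -?ltn_subRL.
Qed.

Lemma derives_resolvent (G : {fset clause Sg}) C1 C2 C :
  derives G C1 -> derives G C2 -> resolvent C1 C2 C -> derives G C.
Proof.
move=> [d1 H1] [d2 H2] res; exists (rcons d1 C1 ++ rcons d2 C2).
have H := derivation_cat H1 H2.
have nth2 : nth fset0 (rcons d1 C1 ++ rcons d2 C2) (size d1 + (size d2).+1) = C2.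
  by rewrite -addSnnS nth_cat size_rcons ltnNge leq_addr /= addKn nth_rcons ltnn eqxx.
have nth1 : nth fset0 (rcons d1 C1 ++ rcons d2 C2) (size d1) = C1.
  by rewrite nth_cat size_rcons ltnSn nth_rcons ltnn eqxx.
have size_d : size (rcons d1 C1 ++ rcons d2 C2) = (size d1 + (size d2).+1).+1.
  by rewrite size_cat !size_rcons addSn.
move=> i; rewrite size_rcons ltnS leq_eqVlt => /orP[/eqP->|lt_i].
  constructor 2; exists (size d1), (size d1 + (size d2).+1)%N.
  rewrite !nth_rcons size_d ltnn eqxx !ltnS leq_addr leqnn nth1 nth2.
  by split.
have nthE j : j < size (rcons d1 C1 ++ rcons d2 C2) ->
    nth fset0 (rcons (rcons d1 C1 ++ rcons d2 C2) C) j
    = nth fset0 (rcons d1 C1 ++ rcons d2 C2) j by move=> lt_j; rewrite nth_rcons lt_j.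
rewrite nthE //; case: (H i lt_i) => [|[j [k [ji ki]]]|[j ji]].
- by constructor 1.
- by constructor 2; exists j, k; rewrite !nthE // ?(ltn_trans ji) ?(ltn_trans ki).
- by constructor 3; exists j; rewrite // nthE // (ltn_trans ji).
Qed.

End Clauses.

(** * Most general Sigma-unifiers and lifting of resolution steps *)

Section Resolution.
Variable Sg : signature.
Hypothesis glbs : has_glbs Sg.
Hypothesis no_bot : forall t : term Sg, well_sorted t -> sort_of t != \bot%O.
Variable x0 : var Sg.
Implicit Types (C D : clause Sg) (L : literal Sg) (r s tau : var Sg -> term Sg).

Lemma common_generalization (U : Type) (u0 : U) (sigma : U -> var Sg -> term Sg) :
  (forall u, sigma_subst (sigma u)) ->
  exists s, [/\ sigma_subst s,
    forall u, exists2 r, sigma_subst r & forall x, sigma u x = subst_term r (s x) &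
    forall t t', (forall u, subst_term (sigma u) t = subst_term (sigma u) t') ->
      subst_term s t = subst_term s t'].
Proof.
move=> sigma_ok.
have [name [back [back_ok nameP]]] := exists_naming glbs no_bot u0 sigma_ok x0.
have reach x : reachable sigma (sigma^~ x) by exists (x, [::]).
have gen_ok x := genP sigma_ok nameP (erefl (sigma u0 x)) (reach x).
exists (gen_subst u0 sigma name); split.
- move=> x; have [wgen sgen _] := gen_ok x; split=> //.
  by apply: sgen => u; have [] := sigma_ok u x.
- move=> u; exists (instantiation back u); first exact: instantiation_ok.
  by move=> x; have [_ _ ->] := gen_ok x.
- move=> t t' eq_t; rewrite -!gen_subst_term eq_t; congr gen.
  exact: funext.
Qed.

(** Generalize the family of all Sigma-unifiers of [E], nonempty because of [tau]. The result still
    unifies [E], since it identifies whatever all of them identify. *)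
Lemma mgu_exists tau (E : {fset literal Sg}) :
  sigma_unifier tau E -> exists s, sigma_mgu s E.
Proof.
move=> tauE; pose U := {r : var Sg -> term Sg | sigma_unifier r E}.
have [u|s [s_ok s_gen s_eq]] :=
  @common_generalization U (exist _ tau tauE) (fun u => projT1 u).
  by have [] := projT2 u.
exists s; split; last first.
  by move=> r rE; apply: (s_gen (exist _ r rE)).
split=> // L1 L2 L1E L2E.
have unify r : sigma_unifier r E -> subst_literal r L1 = subst_literal r L2.
  by case=> _; apply.
have [b_eq p_eq _] := unify _ tauE.
rewrite /subst_literal b_eq p_eq; congr (_, (_, _)).
have {unify} : forall u : U, map (subst_term (projT1 u)) (literal_args L1)
    = map (subst_term (projT1 u)) (literal_args L2).
  by move=> [r rE]; have [] := unify r rE.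
elim: (literal_args L1) (literal_args L2) => [|t ts IH] [|t' ts'] eq_ts //=.
- by have := eq_ts (exist _ tau tauE).
- by have := eq_ts (exist _ tau tauE).
rewrite (s_eq t t') ?(IH ts') // => u; by have [] := eq_ts u.
Qed.

Lemma occurs_renamed (r : var Sg -> var Sg) x t :
  occurs x (subst_term (fun y => Var (r y)) t) -> exists y, x = r y.
Proof.
elim/term_nested_ind: t => [y|f ts IH] /=; first by move/eqP; exists y.
by rewrite has_map => /hasP[t /IH].
Qed.

Lemma occurs_renamed_clause (r : var Sg -> var Sg) x C :
  occurs_clause x (subst_clause (fun y => Var (r y)) C) -> exists y, x = r y.
Proof.
move=> [_ /subst_clauseP[L _ ->]] /=.
by rewrite has_map => /hasP[t _ /occurs_renamed].
Qed.

(** Resolving at once upon all literals that become [a] or its negation makes separate factoring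
    steps unnecessary. *)
Lemma lift_resolution C1 C2 tau1 tau2 (a : atom Sg) :
  sigma_clause C1 -> sigma_clause C2 -> sigma_subst tau1 -> sigma_subst tau2 ->
  (true, a) \in subst_clause tau1 C1 -> (false, a) \in subst_clause tau2 C2 ->
  exists C rho, [/\ resolvent C1 C2 C, sigma_clause C, sigma_subst rho &
    subst_clause rho C = (subst_clause tau1 C1 `\ (true, a))
                     `|` (subst_clause tau2 C2 `\ (false, a))].
Proof.
move=> C1_ok C2_ok tau1_ok tau2_ok posC1 negC2.
(* Even and odd indices standardize the clauses apart; [tau] reads the parity to apply [tau1] or
   [tau2] to the original variable. *)
pose r1 (x : var Sg) : var Sg := (x.1.*2, x.2).
pose r2 (x : var Sg) : var Sg := (x.1.*2.+1, x.2).
have r1_ren : renaming r1.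
  by split=> // -[n w] [n' w'] [/double_inj-> ->].
have r2_ren : renaming r2.
  by split=> // -[n w] [n' w'] [/double_inj-> ->].
pose tau (x : var Sg) := (if odd x.1 then tau2 else tau1) (x.1./2, x.2).
have tau_ok : sigma_subst tau.
  by move=> x; rewrite /tau; case: odd; [exact: tau2_ok|exact: tau1_ok].
pose D1 := subst_clause (fun x => Var (r1 x)) C1.
pose D2 := subst_clause (fun x => Var (r2 x)) C2.
have tauD1 : subst_clause tau D1 = subst_clause tau1 C1.
  rewrite subst_clause_comp; congr subst_clause; apply: funext => -[n w].
  by rewrite /= /tau /= odd_double doubleK.
have tauD2 : subst_clause tau D2 = subst_clause tau2 C2.
  rewrite subst_clause_comp; congr subst_clause; apply: funext => -[n w].
  by rewrite /= /tau /= odd_double uphalf_double.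
have D1_ok : sigma_clause D1 by apply: sigma_subst_clause.
have D2_ok : sigma_clause D2 by apply: sigma_subst_clause.
pose m := [fset L in D1 | subst_literal tau L == (true, a)].
pose n := [fset L in D2 | subst_literal tau L == (false, a)].
have tau_m L : L \in m `|` [fset neg L | L in n] -> subst_literal tau L = (true, a).
  move=> /fsetUP[|/imfsetP[K + ->]]; first by rewrite !inE => /andP[_ /eqP].
  rewrite !inE => /andP[_ /eqP]; rewrite /subst_literal /neg /=.
  by move=> [-> ->].
have [s s_mgu] : exists s, sigma_mgu s (m `|` [fset neg L | L in n]).
  by apply: (@mgu_exists tau); split=> // L1 L2 /tau_m-> /tau_m->.
have [[s_ok _] s_gen] := s_mgu.
(* As [tau] factors through [s] at all variables, [rho] sends the resolvent to the propositional
   one. *)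
have [|rho rho_ok tauE] := s_gen tau; first by split=> // L1 L2 /tau_m-> /tau_m->.
exists (subst_clause s (D1 `\` m) `|` subst_clause s (D2 `\` n)), rho; split=> //.
- exists D1, D2, m, n, s; split; last split=> //.
  + split; [by exists r1|by exists r2|].
    move=> x [/occurs_renamed_clause[y ->] /occurs_renamed_clause[z [yz _]]].
    by have := congr1 odd yz; rewrite /= !odd_double.
  + split=> //.
    * by apply/fsubsetP => L; rewrite !inE => /andP[].
    * by apply/fsubsetP => L; rewrite !inE => /andP[].
    * move: posC1; rewrite -tauD1 => /subst_clauseP[L LD1 e].
      by apply/fset0Pn; exists L; rewrite !inE LD1 -e /=.
    * move: negC2; rewrite -tauD2 => /subst_clauseP[L LD2 e].
      by apply/fset0Pn; exists L; rewrite !inE LD2 -e /=.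
- move=> L /fsetUP[]; apply: sigma_subst_clause => // K; rewrite inE => /andP[_].
    exact: D1_ok.
  exact: D2_ok.
have tau_comp : (fun x => subst_term rho (s x)) = tau.
  by apply: funext => x; rewrite tauE.
rewrite subst_clauseU !subst_clause_comp tau_comp !subst_clause_remove.
by rewrite tauD1 tauD2.
Qed.

End Resolution.

(** * Passage between structures and propositional valuations *)

Section Valuations.
Variable Sg : signature.

(** Restricting the premise to occurring variables lets ground terms be evaluated before any
    assignment is known to exist. *)
Lemma eval_sort (M : structure Sg) (v : var Sg -> M) t w :
  (forall x, occurs x t -> sort_int (vsort x) (v x)) ->
  well_sorted t && (sort_of t <= w)%O -> sort_int w (eval v t).
Proof.
elim/term_nested_ind: t w => [x|f ts IH] w v_ok /andP[wt le_w];
  apply: (sort_int_mono le_w); first by apply: v_ok; rewrite /= eqxx.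
apply: fun_int_sort; move: wt {le_w} => /=.
elim: ts (fargs f) IH v_ok => [|t ts IHts] [|s ss] //= IH v_ok.
move=> /andP[wt wts]; constructor.
  by apply: IH => // [|x xt]; [exact: mem_head|apply: v_ok; rewrite /= xt].
apply: IHts => // [u u_ts|x xts]; last by apply: v_ok; move: xts => /= ->; rewrite orbT.
by apply: IH; rewrite inE u_ts orbT.
Qed.

Lemma eval_subst (M : structure Sg) (v : var Sg -> M) s t :
  eval v (subst_term s t) = eval (fun x => eval v (s x)) t.
Proof.
elim/term_nested_ind: t => [x|f ts IH] //=; congr fun_int.
by rewrite -map_comp; apply/eq_in_map => t /IH.
Qed.

Lemma exists_assignment (M : structure Sg) :
  sorts_inhabited Sg -> exists v : var Sg -> M, assignment v.
Proof.
move=> inhabited; have [a _] := top_nonempty M.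
suff /choice[v v_ok] : forall x : var Sg, exists b : M, sort_int (vsort x) b.
  by exists v.
move=> [n [s s_bot]]; have [t [wt closed_t le_s]] := inhabited s (elimN eqP s_bot).
exists (eval (fun=> a) t); apply: eval_sort; last by rewrite wt.
by move=> x; rewrite (negPf (closed_t x)).
Qed.

Definition valuation (M : structure Sg) (v : var Sg -> M) (a : atom Sg) : bool :=
  `[< pred_int a.1 (map (eval v) a.2) >].

Lemma sat_valuation (M : structure Sg) (v : var Sg -> M) (G : {fset clause Sg}) C s :
  models M G -> assignment v -> C \in G -> sigma_subst s ->
  sat (valuation v) (subst_clause s C).
Proof.
move=> MG v_ok CG s_ok.
have [|L LC holdsL] := MG C CG (fun x => eval v (s x)).
  by move=> x; apply: eval_sort => [y _|]; [exact: v_ok|apply/andP/s_ok].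
apply/satP; exists (subst_literal s L); first exact: mem_subst_clause.
have evalE : map (eval v) (map (subst_term s) (literal_args L))
    = map (eval (fun x => eval v (s x))) (literal_args L).
  by rewrite -map_comp; apply: eq_map => t /=; rewrite eval_subst.
rewrite /valuation /= evalE; move: holdsL; rewrite /holds_literal.
by case: L.1 => H; [exact/asboolP|exact/asboolPn].
Qed.

(* Terms may contain variables: an assignment in this structure is exactly a
   Sigma-substitution, so no passage to ground terms is needed. *)
Section TermStructure.
Hypothesis no_bot : forall t : term Sg, well_sorted t -> sort_of t != \bot%O.
Variables (x0 : var Sg) (V : atom Sg -> bool).

Definition term_sort (s : sorts Sg) (t : term Sg) : Prop :=
  well_sorted t && (sort_of t <= s)%O.

(** The second conjunct meets the requirement [psymb_int_sort]; on literals of Sigma-clauses [V]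
    alone decides. *)
Definition term_pred (p : psymb Sg) (ts : seq (term Sg)) : Prop :=
  V (inr p, ts) /\ all2 (fun u s => well_sorted u && (sort_of u <= s)%O) ts (pargs p).

Lemma all2_term_sort ts ws :
  all2 (fun u s => well_sorted u && (sort_of u <= s)%O) ts ws <->
  List.Forall2 (fun t s => term_sort s t) ts ws.
Proof.
elim: ts ws => [|t ts IH] [|w ws] /=; split=> // H; first by inversion H.
- by inversion H.
- by move/andP: H => [tw /IH tsw]; constructor.
- by inversion_clear H; apply/andP; split=> //; apply/IH.
Qed.

Lemma term_top : exists t, term_sort \top%O t.
Proof. by exists (Var x0); rewrite /term_sort /= lex1. Qed.

Lemma term_bot t : ~ term_sort \bot%O t.
Proof. by move=> /andP[/no_bot]; rewrite lex0 => /negPf->. Qed.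

Lemma term_sort_mono s1 s2 :
  (s1 <= s2)%O -> forall t, term_sort s1 t -> term_sort s2 t.
Proof.
by move=> le12 t /andP[wt le1]; rewrite /term_sort wt (le_trans le1 le12).
Qed.

Lemma term_fun_sort f ts :
  List.Forall2 (fun t s => term_sort s t) ts (fargs f) ->
  term_sort (fres f) (App f ts).
Proof. by move=> /all2_term_sort ws; rewrite /term_sort lexx andbT. Qed.

Lemma term_pred_sort p ts : term_pred p ts ->
  List.Forall2 (fun t s => term_sort s t) ts (pargs p).
Proof. by case=> _ /all2_term_sort. Qed.

Definition term_structure : structure Sg :=
  Structure term_top term_bot term_sort_mono term_fun_sort term_pred_sort.

(** Evaluation in this structure is substitution, so a clause holds under [v] when [V] satisfies its
    instance by [v]. Sort predicates must be absent because [term_sort], not [V], interprets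
    them. *)
Lemma term_structure_models (G : {fset clause Sg}) :
  sigma_clauses G -> sort_predicate_free G ->
  (forall C s, C \in G -> sigma_subst s -> sat V (subst_clause s C)) ->
  models term_structure G.
Proof.
move=> G_ok sortfree satG C CG v v_ok.
have s_ok : sigma_subst v by move=> x; apply/andP/v_ok.
have /satP[_ /subst_clauseP[L LC ->] VL] := satG C v CG s_ok.
exists L => //.
have := sigma_subst_clause s_ok (G_ok C CG) (mem_subst_clause v LC).
have evalE : map (eval v) (literal_args L) = map (subst_term v) (literal_args L) by [].
rewrite /holds_literal evalE.
case: L LC VL {evalE} => b [[s|p] ts] LC /= VL.
  by case: (sortfree s); exists C, (b, (inl s, ts)).
rewrite /well_sorted_literal /literal_pred /literal_args /= => wL.
move: VL; rewrite /literal_pred /literal_args /=.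
by case: b {LC wL} (wL) => // wL Vp [+ _]; rewrite Vp.
Qed.

End TermStructure.
End Valuations.

(** * Interpolation for Sigma-resolution *)

Theorem theorem5 (Sg : signature)
  (glbs : has_glbs Sg) (inhabited : sorts_inhabited Sg)
  (A B : {fset clause Sg})
  (clausesA : sigma_clauses A) (clausesB : sigma_clauses B)
  (sortfreeA : sort_predicate_free A) (sortfreeB : sort_predicate_free B)
  (satB : ~ sigma_unsat B)
  (unsatAB : sigma_unsat (A `|` B)) :
  exists I : {fset clause Sg},
    [/\ sigma_clauses I,
        derives_all A I,
        sigma_unsat (I `|` B)
      & forall p, pred_occurs p I -> pred_occurs p A /\ pred_occurs p B].
Proof.
(* Any structure will do here: evaluation in it shows that no well-sorted term has sort bottom, and
   that top differs from bottom. *)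
have [M0 _] : exists M, models M B.
  by apply: contrapT => noM; apply: satB => M MB; apply: noM; exists M.
have [v0 v0_ok] := exists_assignment M0 inhabited.
have no_bot (t : term Sg) : well_sorted t -> sort_of t != \bot%O.
  move=> wt; apply/negP => /eqP tbot; apply: (@bot_empty _ M0 (eval v0 t)).
  by apply: eval_sort; rewrite ?wt ?tbot ?lexx.
have top_bot : (\top != \bot :> sorts Sg)%O.
  apply/negP => /eqP tb; have [a] := top_nonempty M0.
  by rewrite tb; apply: bot_empty.
pose x0 : var Sg := (0, exist _ \top%O top_bot).
pose inst (G : {fset clause Sg}) (C : clause Sg) :=
  exists D s, [/\ D \in G, sigma_subst s & C = subst_clause s D].
have [G G_inst G_unsat] : exists2 G : {fset clause Sg},
    (forall C, C \in G -> inst (A `|` B) C) &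
    forall V, exists2 C, C \in G & ~~ sat V C.
  apply: compactness => V; apply: contrapT => allsat.
  apply: (unsatAB (term_structure no_bot x0 V)).
  apply: term_structure_models => [C|s|C s CAB s_ok].
  - by move=> /fsetUP[/clausesA|/clausesB].
  - by move=> [C [L [/fsetUP[CA|CB] LC p]]];
      [apply: (sortfreeA s)|apply: (sortfreeB s)]; exists C, L.
  - apply: contrapT => /negP nsat; apply: allsat.
    by exists (subst_clause s C) => //; exists C, s.
(* The invariant carried through elimination: [C] is an instance of a Sigma-clause derived from [A]
   with predicate symbols from [A]. *)
pose lifts (C D : clause Sg) (s : var Sg -> term Sg) :=
  [/\ derives A D, sigma_clause D,
  forall L, L \in D -> pred_occurs (literal_pred L) A,
  sigma_subst s & C = subst_clause s D].
pose liftable (C : clause Sg) := exists D s, lifts C D s.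
have lift_res C D a : liftable C -> liftable D ->
    (true, a) \in C -> (false, a) \in D ->
    liftable ((C `\ (true, a)) `|` (D `\ (false, a))).
  move=> [C1 [s1 [der1 ok1 pred1 s1_ok ->]]] [C2 [s2 [der2 ok2 pred2 s2_ok ->]]] pos neg.
  have [R [rho [res R_ok rho_ok rhoR]]] :=
    lift_resolution glbs no_bot x0 ok1 ok2 s1_ok s2_ok pos neg.
  exists R, rho; split=> //; first exact: derives_resolvent res.
  move=> L LR; have := mem_subst_clause rho LR; rewrite rhoR.
  by case/fsetUP; rewrite inE => /andP[_ /subst_clauseP[K KC [_ -> _]]];
    [exact: pred1|exact: pred2].
have [GA [GAP GA_inst]] : exists GA : {fset clause Sg},
    (forall C, C \in GA -> liftable C) /\
    forall C, C \in G -> inst A C -> C \in GA.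
  exists [fset C in G | `[< inst A C >]]; split=> C; rewrite !inE; last first.
    by move=> -> ?; apply/asboolP.
  move=> /andP[_ /asboolP[D [s [DA s_ok ->]]]]; exists D, s; split=> //.
  - exact: derives_member.
  - exact: clausesA.
  - by move=> L LD; exists D, L.
have [H [H_lift H_preds H_sat]] :=
  eliminate_atoms (fun a : atom Sg => ~~ `[< pred_occurs a.1 B >]) lift_res GAP.
have /choice[lift liftP] : forall C, exists D, liftable C -> exists s, lifts C D s.
  move=> C; have [[D [s CDs]]|nC] := EM (liftable C); last by exists C.
  by exists D; exists s.
exists [fset lift C | C in H]; split.
- by move=> _ /imfsetP[C /H_lift/liftP[s [_ ok _ _ _]] ->].
- by move=> _ /imfsetP[C /H_lift/liftP[s [der _ _ _ _]] ->].
(* A model of [I] and [B] yields a valuation satisfying [H]. Changing it only at atoms foreign to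
   [B] satisfies [GA] and leaves the instances of [B] true, so all of [G] would be satisfied. *)
- move=> M MIB; have [v v_ok] := exists_assignment M inhabited.
  have satH C : C \in H -> sat (valuation v) C.
    move=> CH; have [s [_ _ _ s_ok ->]] := liftP C (H_lift C CH).
    apply: sat_valuation MIB v_ok _ s_ok; apply/fsetUP; left.
    by apply/imfsetP; exists C.
  have [V V_eq V_sat] := H_sat _ satH.
  have [C CG /negP] := G_unsat V; apply.
  have [D [s [/fsetUP[DA|DB] s_ok CE]]] := G_inst C CG.
    by apply/V_sat/GA_inst => //; exists D, s.
  have /satP[L LC VL] : sat (valuation v) C.
    by rewrite CE; apply: sat_valuation MIB v_ok _ s_ok; apply/fsetUP; right.
  apply/satP; exists L => //; rewrite V_eq // negbK.
  move: LC; rewrite CE => /subst_clauseP[K KD ->].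
  by apply/asboolP; exists D, K.
- move=> p [_ [L [/imfsetP[C CH ->] LC <-]]].
  have [s [_ _ preds _ CE]] := liftP C (H_lift C CH).
  (* Substitution preserves predicate symbols, so those of the lifted clause are those of [C], from
     which the symbols foreign to [B] were eliminated. *)
  split; first exact: preds.
  have := H_preds C (subst_literal s L) CH; rewrite negbK => H1.
  by apply/asboolP/H1; rewrite CE mem_subst_clause.
Qed.
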